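(* Let $R$ be a ring, let $(M_i)_{i\in I}$ be a direct system of projective left $R$-modules, indexed by a directed set $I$ with $|I|<\aleph_\omega$, and let $M=\varinjlim_{i\in I} M_i$. If the (flat) module $M$ is Gorenstein projective, then $M$ is projective.
   Context: Rings are associative with identity. An exact sequence $\cdots\to P^{-1}\to P^0\to P^1\to\cdots$ of projective $R$-modules is a complete projective resolution if $\operatorname{Hom}_R(-,P)$ leaves it exact for every projective $R$-module $P$. A module $M$ is Gorenstein projective if $M\cong\ker(P^0\to P^1)$ for some complete projective resolution. *)

(* Defs.v *)
From HB Require Import structures.
From mathcomp Require Import all_boot all_order all_algebra.
From mathcomp Require Import boolp classical_sets functions cardinality.

Set Implicit Arguments.
Unset Strict Implicit.
Unset Printing Implicit Defensive.

Import Order.TTheory GRing.Theory.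
Local Open Scope ring_scope.
Local Open Scope classical_set_scope.
Local Open Scope card_scope.

(* Modules are left modules: [lmodType R] for [R : pzRingType], so that R is an
   arbitrary associative ring with identity, the zero ring included. *)

Definition projective (R : pzRingType) (P : lmodType R) : Prop :=
  forall (A B : lmodType R) (g : {linear A -> B}) (f : {linear P -> B}),
    (forall b : B, exists a : A, g a = b) ->
    exists h : {linear P -> A}, forall x : P, g (h x) = f x.

(* With [d n : P n -> P (n + 1)], the conditions below are indexed by the
   middle term P (n + 1); every integer is of the form n + 1. *)
Definition exact_sequence (R : pzRingType) (P : int -> lmodType R)
    (d : forall n : int, {linear P n -> P (n + 1)}) : Prop :=
  forall (n : int) (x : P (n + 1)),
    d (n + 1) x = 0 <-> exists y : P n, d n y = x.

(* Exactness of
   Hom(P (n + 1 + 1), Q) -> Hom(P (n + 1), Q) -> Hom(P n, Q) for all n. *)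
Definition Hom_exact (R : pzRingType) (P : int -> lmodType R)
    (d : forall n : int, {linear P n -> P (n + 1)}) (Q : lmodType R) : Prop :=
  forall (n : int) (f : {linear P (n + 1) -> Q}),
    (forall y : P n, f (d n y) = 0) <->
    exists g : {linear P (n + 1 + 1) -> Q},
      forall x : P (n + 1), g (d (n + 1) x) = f x.

Definition complete_projective_resolution (R : pzRingType)
    (P : int -> lmodType R) (d : forall n : int, {linear P n -> P (n + 1)}) :
    Prop :=
  [/\ forall n, projective (P n),
      exact_sequence d &
      forall Q : lmodType R, projective Q -> Hom_exact d Q].

(* The isomorphism M ~ ker (P 0 -> P 1) is given as an injective linear map
   M -> P 0 whose image is that kernel. *)
Definition Gorenstein_projective (R : pzRingType) (M : lmodType R) : Prop :=
  exists (P : int -> lmodType R) (d : forall n : int, {linear P n -> P (n + 1)}),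
    complete_projective_resolution d /\
    exists u : {linear M -> P 0},
      injective u /\ forall x : P 0, d 0 x = 0 <-> exists m : M, u m = x.

Definition directed (disp : Order.disp_t) (I : preorderType disp) : Prop :=
  (exists i : I, True) /\
  forall i j : I, exists k : I, (i <= k)%O /\ (j <= k)%O.

Record direct_system (R : pzRingType) (disp : Order.disp_t)
    (I : preorderType disp) := DirectSystem {
  dsys_obj :> I -> lmodType R;
  dsys_map : forall i j : I, (i <= j)%O -> {linear dsys_obj i -> dsys_obj j};
  dsys_map_id : forall (i : I) (ii : (i <= i)%O) (x : dsys_obj i),
    dsys_map ii x = x;
  dsys_map_comp : forall (i j k : I) (ij : (i <= j)%O) (jk : (j <= k)%O)
    (ik : (i <= k)%O) (x : dsys_obj i),
    dsys_map jk (dsys_map ij x) = dsys_map ik x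
}.
Arguments dsys_map {R disp I} S {i j} ij : rename.

Definition cocone (R : pzRingType) (disp : Order.disp_t)
    (I : preorderType disp) (S : direct_system R I) (N : lmodType R)
    (f : forall i : I, {linear S i -> N}) : Prop :=
  forall (i j : I) (ij : (i <= j)%O) (x : S i),
    f j (dsys_map S ij x) = f i x.

Definition is_direct_limit (R : pzRingType) (disp : Order.disp_t)
    (I : preorderType disp) (S : direct_system R I) (M : lmodType R)
    (f : forall i : I, {linear S i -> M}) : Prop :=
  cocone f /\
  forall (N : lmodType R) (g : forall i : I, {linear S i -> N}), cocone g ->
    exists h : {linear M -> N},
      (forall (i : I) (x : S i), h (f i x) = g i x) /\
      forall h' : {linear M -> N},
        (forall (i : I) (x : S i), h' (f i x) = g i x) ->
        forall m : M, h' m = h m.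

Definition type_card_le (X Y : Type) : Prop := [set: X] #<= [set: Y].

Definition type_card_lt (X Y : Type) : Prop := type_card_le X Y /\ ~ type_card_le Y X.

(* [is_aleph n X]: the cardinality of X is aleph_n. *)
Fixpoint is_aleph (n : nat) (X : Type) : Prop :=
  match n with
  | 0 => [set: X] #= [set: nat]
  | n'.+1 => exists Y : Type,
      [/\ is_aleph n' Y, type_card_lt Y X &
          forall Z : Type, type_card_lt Y Z -> type_card_le X Z]
  end.

(* The cardinality of X is aleph_omega, the supremum of the aleph_n. *)
Definition is_aleph_omega (X : Type) : Prop :=
  (forall (n : nat) (Y : Type), is_aleph n Y -> type_card_le Y X) /\
  forall Z : Type,
    (forall (n : nat) (Y : Type), is_aleph n Y -> type_card_le Y Z) ->
    type_card_le X Z.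

Definition card_lt_aleph_omega (X : Type) : Prop :=
  exists W : Type, is_aleph_omega W /\ type_card_lt X W.

(* Main.v *)
(** The bar complex B_k, the direct sum of the S_{i_0} over all chains
    i_0 <= ... <= i_k, is a resolution of M by projective modules, and Hom(B, N)
    computes the derived limits of the system Hom(S_i, N). By Goblot's argument
    these vanish in degrees > n + 1 when |I| <= aleph_n: primitives of a cocycle
    are extended by transfinite recursion along a chain of smaller directed
    subsets, starting from subsets with a maximum, where coning off the maximum
    is a contracting homotopy. Hence the boundaries in some degree of B form a
    direct summand. If P is a complete projective resolution, then Hom(P, B_k)
    is exact, and descending along B shows that Hom(P, M) is exact too.
    Extending the surjection P^{-1} -> M along P^{-1} -> P^0 gives a retraction
    of M -> P^0. *)

Require Import Defs.
From HB Require Import structures.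
From mathcomp Require Import all_boot all_order all_algebra.
From mathcomp Require Import finmap.
From mathcomp Require Import boolp classical_sets functions cardinality fsbigop.
From mathcomp Require wochoice.

Set Implicit Arguments.
Unset Strict Implicit.
Unset Printing Implicit Defensive.

Import Order.TTheory GRing.Theory.
Local Open Scope ring_scope.
Local Open Scope classical_set_scope.
Local Open Scope card_scope.

(** * Modules *)

Lemma linear_fun_exists (R : pzRingType) (U V : lmodType R) (f : U -> V) :
  linear f -> exists g : {linear U -> V}, forall x, g x = f x.
Proof.
move=> f_lin.
pose g : {linear U -> V} :=
  HB.pack f (@GRing.isLinear.Build R U V _ f f_lin).
by exists g.
Qed.

Section Submodule.

Variables (R : pzRingType) (V : lmodType R) (p : V -> Prop).
Hypothesis p0 : p 0.
Hypothesis pZD : forall a x y, p x -> p y -> p (a *: x + y).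

Let pb : {pred V} := fun v => `[< p v >].

Let pb_submod_closed : submod_closed pb.
Proof.
split=> [|a x y]; first exact/asboolP.
by move=> /asboolP px /asboolP py; apply/asboolP; apply: pZD.
Qed.

HB.instance Definition _ := GRing.isSubmodClosed.Build R V pb pb_submod_closed.

Let subT := {v : V | v \in pb}.

HB.instance Definition _ := SubChoice.on subT.
HB.instance Definition _ := [SubChoice_isSubLmodule of subT by <:].

Lemma submodule_exists :
  exists (K : lmodType R) (i : {linear K -> V}),
    injective i /\ forall v, p v <-> exists k, i k = v.
Proof.
exists subT, (val : {linear subT -> V}); split=> [|v]; first exact: val_inj.
split=> [pv | [k <-]]; last exact/asboolP/(valP k).
by exists (Sub v (asboolT pv) : subT).
Qed.

End Submodule.

(** Corestricting both maps to the image of [g], which contains that of [f], makes [g] surjective,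
    so the lifting property applies. *)
Lemma projective_lift (R : pzRingType) (P A B : lmodType R)
    (f : {linear P -> B}) (g : {linear A -> B}) :
  projective P -> (forall x, exists a, g a = f x) ->
  exists h : {linear P -> A}, forall x, g (h x) = f x.
Proof.
move=> projP f_im.
have [||K [i [i_inj imi]]] :=
  @submodule_exists R B (fun b => exists a, g a = b).
- by exists 0; rewrite linear0.
- by move=> a _ _ [x <-] [y <-]; exists (a *: x + y); rewrite linearP.
have corestrict (C : lmodType R) (k : {linear C -> B}) :
    (forall x, exists a, g a = k x) ->
    exists k' : {linear C -> K}, forall x, i (k' x) = k x.
  move=> k_im; have /choice[k' k'E] x : exists y, i y = k x.
    exact/imi.
  have [|k'' k''E] := @linear_fun_exists R C K k'.
    by move=> a x y; apply: i_inj; rewrite linearP !k'E linearP.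
  by exists k'' => x; rewrite k''E.
have [f' f'E] := corestrict P f f_im.
have [|g' g'E] := corestrict A g; first by move=> x; exists x.
have [|h hE] := projP A K g' f'.
  move=> b; have /imi[a aE] : exists k, i k = i b by exists b.
  by exists a; apply: i_inj; rewrite g'E.
by exists h => x; rewrite -g'E hE f'E.
Qed.

Lemma projective_retract (R : pzRingType) (M P : lmodType R)
    (u : {linear M -> P}) (v : {linear P -> M}) :
  projective P -> (forall m, v (u m) = m) -> projective M.
Proof.
move=> projP vu A B g f g_surj.
have [h hE] := projP A B g (f \o v) g_surj.
by exists (h \o u) => x /=; rewrite hE /= vu.
Qed.

Section Quotient.

Variables (R : pzRingType) (V : lmodType R) (p : V -> Prop).
Hypothesis p0 : p 0.
Hypothesis pZD : forall a x y, p x -> p y -> p (a *: x + y).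

Let pD x y : p x -> p y -> p (x + y).
Proof. by move=> px py; have := pZD 1 px py; rewrite scale1r. Qed.

Let pN x : p x -> p (- x).
Proof. by move=> px; have := pZD (-1) px p0; rewrite scaleN1r addr0. Qed.

Let pZ a x : p x -> p (a *: x).
Proof. by move=> px; have := pZD a px p0; rewrite addr0. Qed.

(** The quotient is carried by chosen coset representatives. The default of [xget] is never reached,
    since [x] lies in its own coset. *)
Let rep (x : V) : V := xget 0 [set y | p (x - y)].

Let repP x : p (x - rep x).
Proof.
by apply: (@xgetPex _ 0 [set y | p (x - y)]); exists x; rewrite /= subrr.
Qed.

Let rep_eq x y : p (x - y) -> rep x = rep y.
Proof.
move=> pxy; congr (xget 0 _); apply/seteqP; split=> z /= pz.
  by have := pD (pN pxy) pz; rewrite opprB addrA subrK.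
by have := pD pxy pz; rewrite addrA subrK.
Qed.

Let quotT := {x : V | rep x == x}.

Let pi (x : V) : quotT.
Proof.
by exists (rep x); apply/eqP/rep_eq; rewrite -opprB; apply/pN/repP.
Defined.

Let piK (k : quotT) : pi (val k) = k.
Proof. by apply: val_inj => /=; apply/eqP/(valP k). Qed.

Let pi_eq x y : p (x - y) -> pi x = pi y.
Proof. by move=> pxy; apply: val_inj; apply: rep_eq. Qed.

Let qadd (k l : quotT) := pi (val k + val l).
Let qscale a (k : quotT) := pi (a *: val k).

Let piD x y : pi (x + y) = qadd (pi x) (pi y).
Proof. by apply: pi_eq; rewrite opprD addrACA; apply: pD; apply: repP. Qed.

Let piZ a x : pi (a *: x) = qscale a (pi x).
Proof. by apply: pi_eq; rewrite -scalerBr; apply/pZ/repP. Qed.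

Let qaddA : associative qadd.
Proof. by move=> k l m; rewrite -(piK k) -(piK l) -(piK m) -!piD addrA. Qed.

Let qaddC : commutative qadd.
Proof. by move=> k l; rewrite /qadd addrC. Qed.

Let qadd0 : left_id (pi 0) qadd.
Proof. by move=> k; rewrite -(piK k) -piD add0r. Qed.

Let qaddN : left_inverse (pi 0) (fun k : quotT => pi (- val k)) qadd.
Proof. by move=> k; rewrite -{2}(piK k) -piD addNr. Qed.

HB.instance Definition _ := Choice.on quotT.
HB.instance Definition _ := GRing.isZmodule.Build quotT qaddA qaddC qadd0 qaddN.

Let qscaleA a b k : qscale a (qscale b k) = qscale (a * b) k.
Proof. by rewrite -(piK k) -!piZ scalerA. Qed.

Let qscale1 : left_id 1 qscale.
Proof. by move=> k; rewrite -(piK k) -piZ scale1r. Qed.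

Let qscaleDr : right_distributive qscale +%R.
Proof.
move=> a k l; rewrite -(piK k) -(piK l).
have -> (x y : V) : pi x + pi y = pi (x + y) by rewrite piD.
by rewrite -!piZ scalerDr piD.
Qed.

Let qscaleDl k : {morph qscale^~ k : a b / a + b}.
Proof. by move=> a b; rewrite -(piK k) -!piZ scalerDl piD. Qed.

HB.instance Definition _ :=
  GRing.Zmodule_isLmodule.Build R quotT qscaleA qscale1 qscaleDr qscaleDl.

Lemma quotient_exists :
  exists (Q : lmodType R) (q : {linear V -> Q}), forall v, q v = 0 <-> p v.
Proof.
have [|q qE] := @linear_fun_exists R V quotT pi.
  by move=> a x y; rewrite piD piZ.
exists quotT, q => v; rewrite qE; split=> [|pv]; last first.
  by apply: pi_eq; rewrite subr0.
(* Only [rep v = rep 0] is known, and [rep 0] need not be [0]; it cancels because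
   [p (0 - rep 0)]. *)
move=> /(congr1 val) /= rep_v0.
have := repP v; rewrite rep_v0 => pv; have := pD pv (pN (repP 0)).
by rewrite sub0r opprK subrK.
Qed.

End Quotient.

Section DirectSum.

Variables (R : pzRingType) (J : choiceType) (T : J -> lmodType R).

Let prodT := forall j, T j.

Let add (y z : prodT) : prodT := fun j => y j + z j.
Let zero : prodT := fun j => 0.
Let opp (y : prodT) : prodT := fun j => - y j.
Let scale a (y : prodT) : prodT := fun j => a *: y j.

Let addA : associative add.
Proof.
by move=> x y z; apply/functional_extensionality_dep => j; exact: addrA.
Qed.

Let addC : commutative add.
Proof.
by move=> x y; apply/functional_extensionality_dep => j; exact: addrC.
Qed.

Let add0 : left_id zero add.
Proof.
by move=> x; apply/functional_extensionality_dep => j; exact: add0r.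
Qed.

Let addN : left_inverse zero opp add.
Proof.
by move=> x; apply/functional_extensionality_dep => j; exact: addNr.
Qed.

Let prodZ : zmodType :=
  HB.pack prodT (gen_eqMixin prodT) (gen_choiceMixin prodT)
    (GRing.isZmodule.Build prodT addA addC add0 addN).

Let scaleA a b (y : prodZ) : scale a (scale b y) = scale (a * b) y.
Proof. by apply/functional_extensionality_dep => j; exact: scalerA. Qed.

Let scale1 : left_id 1 (scale : R -> prodZ -> prodZ).
Proof.
by move=> y; apply/functional_extensionality_dep => j; exact: scale1r.
Qed.

Let scaleDr : right_distributive (scale : R -> prodZ -> prodZ) +%R.
Proof.
by move=> a y z; apply/functional_extensionality_dep => j; exact: scalerDr.
Qed.

Let scaleDl (y : prodZ) : {morph (fun a => scale a y : prodZ) : a b / a + b}.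
Proof.
by move=> a b; apply/functional_extensionality_dep => j; exact: scalerDl.
Qed.

Let prod : lmodType R :=
  HB.pack prodT prodZ
    (GRing.Zmodule_isLmodule.Build R prodZ scaleA scale1 scaleDr scaleDl).

Let prodD (x y : prod) j : (x + y : prod) j = x j + y j. Proof. by []. Qed.
Let prodZE a (x : prod) j : (a *: x : prod) j = a *: x j. Proof. by []. Qed.

Let delta j (x : T j) : prod := fun k =>
  match j =P k with
  | ReflectT e => ecast k (T k) e x
  | ReflectF _ => 0
  end.

Let delta_diag j x : delta x j = x.
Proof. by rewrite /delta; case: eqP => // e; rewrite eq_axiomK. Qed.

Let delta_off j k x : j != k -> @delta j x k = 0.
Proof. by rewrite /delta; case: eqP. Qed.

Let delta_linear j : linear (@delta j).
Proof.
move=> a x y; apply/functional_extensionality_dep => k.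
rewrite prodD prodZE; have [<-|jk] := eqVneq j k; first by rewrite !delta_diag.
by rewrite !delta_off // scaler0 addr0.
Qed.

(** Finite support is encoded by how an element is built up, so that the induction principle of the
    direct sum is an induction on this predicate. *)
Inductive spanned : prod -> Prop :=
| Spanned0 : spanned 0
| SpannedD j x y : spanned y -> spanned (@delta j x + y).

Let spannedZD a x y : spanned x -> spanned y -> spanned (a *: x + y).
Proof.
elim=> [|j z {}x _ IH] span_y; first by rewrite scaler0 add0r.
rewrite scalerDr -addrA; have -> : a *: delta z = delta (a *: z).
  have d0 : delta (0 : T j) = 0.
    by have := delta_linear (-1) (0 : T j) 0; rewrite !scaleN1r !addNr.
  by have := delta_linear a z 0; rewrite d0 !addr0.
exact/SpannedD/IH.
Qed.

Let spanned_support y :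
  spanned y -> exists A : {fset J}, forall j, j \notin A -> y j = 0.
Proof.
elim=> [|j x {}y _ [A yA]]; first by exists fset0.
exists (j |` A)%fset => k; rewrite in_fset1U negb_or eq_sym => /andP[jk kA].
by rewrite prodD delta_off // yA // addr0.
Qed.

Lemma direct_sum_exists :
  exists (D : lmodType R) (io : forall j, {linear T j -> D}),
    (forall (N : lmodType R) (g : forall j, {linear T j -> N}),
      exists h : {linear D -> N}, forall j x, h (io j x) = g j x) /\
    (forall E : D -> Prop, E 0 -> (forall x y, E x -> E y -> E (x + y)) ->
      (forall j x, E (io j x)) -> forall x, E x).
Proof.
have [D [i [i_inj imi]]] := submodule_exists Spanned0 spannedZD.
have /choice[io0 io0E] (jx : {j & T j}) : exists d, i d = delta (tagged jx).
  by apply/imi; rewrite -[delta _]addr0; apply/SpannedD/Spanned0.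
have ioP j : exists io : {linear T j -> D}, forall x, i (io x) = delta x.
  have [|f fE] := @linear_fun_exists R (T j) D (fun x => io0 (Tagged T x)).
    by move=> a x y; apply: i_inj; rewrite linearP !io0E /= delta_linear.
  by exists f => x; rewrite fE io0E.
pose io j := sval (cid (ioP j)).
have ioE j x : i (io j x) = delta x by rewrite /io; case: cid.
exists D, io; split=> [N g|E E0 ED Eio x].
  (* A sum over the whole index type, meaningful because supports are finite; [hE] computes it on
     any finite set containing the support, so two elements can share one. *)
  pose h (d : D) := \sum_(j \in setT) g j (i d j).
  have suppD d : exists A : {fset J}, forall j, j \notin A -> i d j = 0.
    by apply/spanned_support/imi; exists d.
  have hE d (A : {fset J}) : (forall j, j \notin A -> i d j = 0) ->
      h d = \sum_(j <- A) g j (i d j).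
    by move=> dA; apply: fsbigTE => j jA; rewrite dA // linear0.
  have [|h' h'E] := @linear_fun_exists R D N h.
    move=> a x y; have [[A xA] [B yB]] := (suppD x, suppD y).
    have xAB j : j \notin (A `|` B)%fset -> i x j = 0.
      by rewrite in_fsetU negb_or => /andP[/xA].
    have yAB j : j \notin (A `|` B)%fset -> i y j = 0.
      by rewrite in_fsetU negb_or => /andP[_ /yB].
    rewrite (hE _ _ xAB) (hE _ _ yAB) (hE _ (A `|` B)%fset).
      rewrite scaler_sumr -big_split.
      by apply: eq_bigr => j _; rewrite !linearP.
    by move=> j jAB; rewrite linearP prodD prodZE xAB // yAB // scaler0 addr0.
  exists h' => j x; rewrite h'E (hE _ [fset j]%fset).
    by rewrite big_seq_fset1 ioE delta_diag.
  by move=> k; rewrite in_fset1 ioE eq_sym => /delta_off.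
suff span_E y : spanned y -> forall x, i x = y -> E x.
  by apply: span_E (erefl (i x)); apply/imi; exists x.
elim=> [|j z {}y _ IH] {}x xE.
  by rewrite (_ : x = 0) //; apply: i_inj; rewrite xE linear0.
rewrite (_ : x = io j z + (x - io j z)); last by rewrite addrC subrK.
by apply: ED => //; apply: IH; rewrite linearB ioE xE addrAC subrr add0r.
Qed.

End DirectSum.

Lemma direct_sum_projective (R : pzRingType) (J : Type) (T : J -> lmodType R)
    (D : lmodType R) (io : forall j, {linear T j -> D}) :
  (forall (N : lmodType R) (g : forall j, {linear T j -> N}),
    exists h : {linear D -> N}, forall j x, h (io j x) = g j x) ->
  (forall E : D -> Prop, E 0 -> (forall x y, E x -> E y -> E (x + y)) ->
    (forall j x, E (io j x)) -> forall x, E x) ->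
  (forall j, projective (T j)) -> projective D.
Proof.
move=> univ ind projT A B g f g_surj.
have liftP j : exists h : {linear T j -> A}, forall x, g (h x) = (f \o io j) x.
  exact: projT.
have [h hE] := univ A (fun j => sval (cid (liftP j))).
exists h; apply: ind => [|x y gx gy|j x]; first by rewrite !linear0.
  by rewrite !linearD gx gy.
by rewrite hE; case: cid.
Qed.

(** * Cardinals *)

Lemma card_le_injP T U (u0 : U) (A : set T) :
  A #<= [set: U] <-> exists f : T -> U, {in A &, injective f}.
Proof.
elim/Ppointed: U => U in u0 *; first by case: (no u0).
by split=> /pcard_injP.
Qed.

Lemma inj_card_le_set T U (f : T -> U) (A : set T) (B : set U) :
  {in A &, injective f} -> (forall x, A x -> B (f x)) -> A #<= B.
Proof.
move=> f_inj fAB; rewrite -(card_le_eql (inj_card_eq f_inj)).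
by apply: subset_card_le => _ [x Ax <-]; apply: fAB.
Qed.

Lemma nat_card_le_inh U : [set: nat] #<= [set: U] -> exists u : U, True.
Proof.
move=> /card_leP[f].
by exists (val (f (SigSub (mem_set (I : [set: nat] 0%N))))).
Qed.

(** Zorn's lemma on graphs of partial injections: if a maximal one missed a point on each side, the
    pair of missed points could be added. *)
Lemma type_card_le_total (T U : Type) : type_card_le T U \/ type_card_le U T.
Proof.
pose partial_inj := [set G : set (T * U) |
  forall p q, G p -> G q -> (p.1 = q.1 <-> p.2 = q.2)].
have [|G [G_inj G_max]] := Zorn_bigcup (P := partial_inj).
  move=> F F_inj F_total p q [X FX Xp] [Y FY Yq].
  have [XY|YX] := F_total X Y FX FY; first exact: (F_inj Y FY p q (XY _ Xp)).
  exact: (F_inj X FX p q Xp (YX _ Yq)).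
have [dom_full|/existsNP[x /forallNP x_dom]] :=
  pselect (forall x, exists y, G (x, y)).
  left; have [f fE] := choice dom_full.
  apply: (@inj_card_le_set _ _ f) => // x y _ _ fxy.
  exact: ((G_inj _ _ (fE x) (fE y)).2 fxy).
have [ran_full|/existsNP[y /forallNP y_ran]] :=
  pselect (forall y, exists x, G (x, y)).
  right; have [f fE] := choice ran_full.
  apply: (@inj_card_le_set _ _ f) => // y z _ _ fyz.
  exact: ((G_inj _ _ (fE y) (fE z)).1 fyz).
case: (G_max ((x, y) |` G)).
  split=> [p Gp|]; first by right.
  by move=> /(_ (x, y) (or_introl erefl)); exact: x_dom.
move=> p q [->|Gp] [->|Gq] //=.
- split=> xy; [case: (x_dom q.2)|case: (y_ran q.1)];
    by rewrite xy -surjective_pairing.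
- split=> xy; [case: (x_dom p.2)|case: (y_ran p.1)];
    by rewrite -xy -surjective_pairing.
- exact: G_inj.
Qed.

(** Hilbert's hotel: [shift] moves a copy of [nat] inside [U] up by one, and the freed value [g 0]
    goes to [a]. *)
Lemma card_le_adjoin T U (A : set T) a :
  [set: nat] #<= [set: U] -> A #<= [set: U] -> a |` A #<= [set: U].
Proof.
move=> natU; have [u0 _] := nat_card_le_inh natU.
have [g g_inj] := (card_le_injP u0 _).1 natU.
move=> /(card_le_injP u0)[f f_inj]; apply/(card_le_injP u0).
have g_injT m n : g m = g n -> m = n by apply: g_inj; rewrite inE.
pose shift v := if pselect (exists n, v = g n) is left ex
  then g (projT1 (cid ex)).+1 else v.
have shiftE v : (exists2 n, v = g n & shift v = g n.+1) \/
    ((forall n, v <> g n) /\ shift v = v).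
  rewrite /shift; case: pselect => [ex|nex]; last first.
    by right; split=> // n vn; apply: nex; exists n.
  by left; case: cid => n /= vn; exists n.
have shift_inj : injective shift.
  move=> v w; have [[m -> ->]|[vN ->]] := shiftE v;
    have [[n -> ->]|[wN ->]] := shiftE w => //.
  - by move=> /g_injT[->].
  - by move=> /esym/wN.
  - by move=> /vN.
have shift_g0 v : shift v <> g 0%N.
  by have [[m _ ->] /g_injT|[vN ->]] := shiftE v.
exists (fun x => if pselect (x = a) then g 0%N else shift (f x)).
move=> x y; rewrite !inE => xA yA.
case: pselect => xa; case: pselect => ya /=; first by rewrite xa ya.
- by move=> /esym/shift_g0.
- by move=> /shift_g0.
move=> /shift_inj; apply: f_inj; rewrite inE.
  by case: xA.
by case: yA.
Qed.

Lemma well_order_exists T : exists lt : T -> T -> Prop,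
  [/\ well_founded lt, forall x y, [\/ lt x y, x = y | lt y x] &
      forall x y z, lt x y -> lt y z -> lt x z].
Proof.
elim/Pchoice: T => T.
have [le le_wo] := wochoice.well_ordering_principle T.
have chainT : wochoice.wo_chain le predT by move=> A _; apply: le_wo.
have le_total x y : le x y || le y x by apply: (wochoice.wo_chainW chainT).
have le_anti x y : le x y -> le y x -> x = y.
  move=> xy yx; apply: (wochoice.wo_chain_antisymmetric chainT) => //.
  by rewrite xy.
have le_min (P : T -> Prop) x : P x -> exists2 m, P m & forall y, P y -> le m y.
  move=> Px; have [|m [[Pm m_min] _]] := le_wo (fun y => `[< P y >]).
    by exists x; apply/asboolP.
  by exists m => [|y Py]; [apply/asboolP|apply: m_min; apply/asboolP].
exists (fun x y => le x y /\ x <> y); split.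
- move=> x; apply: contrapT => xN.
  have [m mN m_min] := le_min (fun z => ~ Acc _ z) x xN; apply: mN.
  constructor => y [ym y_neq]; apply: contrapT => /m_min my.
  by apply: y_neq; apply: le_anti.
- move=> x y; have [->|/eqP xy] := eqVneq x y; first exact: Or32.
  case/orP: (le_total x y) => ?; [apply: Or31|apply: Or33]; split=> //.
  by move=> /esym.
- move=> x y z [xy x_neq] [yz y_neq].
  have xz : le x z.
    (* By antisymmetry the least element of x, y, z can be neither [y] nor [z], so it is [x]. *)
    have [m [->|[->|->]] m_min] :=
      @le_min (fun t => t = x \/ t = y \/ t = z) x (or_introl erefl).
    + by apply: m_min; right; right.
    + by case: x_neq; apply: le_anti => //; apply: m_min; left.
    + by case: y_neq; apply: le_anti => //; apply: m_min; right; left.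
  split=> // xz_eq; apply: y_neq; apply: le_anti => //.
  by rewrite -xz_eq.
Qed.

Lemma is_aleph_infinite n Y : is_aleph n Y -> type_card_le nat Y.
Proof.
elim: n Y => [|n IH] Y /=; first by rewrite card_eq_le => /andP[].
by move=> [Y' [/IH natY' [Y'Y _] _]]; apply: card_le_trans Y'Y.
Qed.

(** [X] embeds into the points of a well-ordered [Y] whose closed initial segments have size at most
    [Y']; these segments are pulled back to [X]. *)
Lemma card_successor_filtration T Y Y' (X : set T) :
  type_card_le nat Y' -> type_card_le Y' Y ->
  (forall Z : Type, type_card_lt Y' Z -> type_card_le Y Z) ->
  X #<= [set: Y] ->
  exists (A : Type) (lt : A -> A -> Prop) (K : A -> set T),
    [/\ well_founded lt, forall a b, [\/ lt a b, a = b | lt b a],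
        forall a b, lt a b -> K a `<=` K b,
        X = \bigcup_a K a & forall a, K a #<= [set: Y']].
Proof.
move=> natY' Y'Y Y_succ XY.
have [lt [lt_wf lt_total lt_trans]] := well_order_exists Y.
pose seg y := [set z | lt z y]; pose good y := (y |` seg y) #<= [set: Y'].
have [e e_inj e_good] :
    exists2 e : T -> Y, {in X &, injective e} & forall x, X x -> good (e x).
  have [all_good|/existsNP[y1]] := pselect (forall y, good y).
    have [y0 _] := nat_card_le_inh (card_le_trans natY' Y'Y).
    by have [e e_inj] := (card_le_injP y0 _).1 XY; exists e.
  (* Descend to a least bad point [y0]. Its open segment consists of good points and is larger than
     [Y'], so by the successor property it has room for [Y], hence for [X]. *)
  elim/(well_founded_ind lt_wf): y1 => y0 IH y0_bad.
  have [seg_good|/existsNP[y /not_implyP[yy0 y_bad]]] :=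
    pselect (forall y, lt y y0 -> good y); last exact: (IH y).
  have seg_big : ~ type_card_le (seg y0) Y'.
    rewrite /type_card_le (card_le_eql (card_setT _)) => segY'.
    by case: y0_bad; apply: card_le_adjoin.
  have Y'_le_seg : type_card_le Y' (seg y0).
    by have [|/seg_big] := type_card_le_total Y' (seg y0).
  have Y_le_seg : type_card_le Y (seg y0) by apply: Y_succ.
  have [z0 _] := nat_card_le_inh (card_le_trans natY' Y'_le_seg).
  have [e e_inj] := (card_le_injP z0 _).1 (card_le_trans XY Y_le_seg).
  exists (fun x => set_val (e x)) => [x x' Xx Xx' /val_inj|x _].
    exact: e_inj.
  by apply: seg_good; apply: (set_valP (e x)).
exists {y | good y}, (fun a b => lt (sval a) (sval b)),
  (fun a => [set x | X x /\ (sval a |` seg (sval a)) (e x)]); split.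
- move=> [a ga]; elim/(well_founded_ind lt_wf): a ga => a IH ga.
  by constructor=> -[b gb] /= ba; apply: IH.
- move=> [a ga] [b gb] /=; have [ab|ab|ba] := lt_total a b.
  + exact: Or31.
  + by apply: Or32; case: _ / ab gb => gb; rewrite (Prop_irrelevance ga gb).
  + exact: Or33.
- move=> a b ab x [Xx xa]; split=> //; right; rewrite /seg /=.
  by case: xa => [->//|xa]; apply: lt_trans xa ab.
- apply/seteqP; split=> [x Xx|x [a _ []]//].
  by exists (exist _ (e x) (e_good x Xx)) => //; split=> //; left.
- move=> a; apply: card_le_trans (svalP a); apply: (inj_card_le_set (f := e)).
    by move=> x x'; rewrite !inE => -[Xx _] [Xx' _]; apply: e_inj; rewrite inE.
  by move=> x [].
Qed.

(** Otherwise, by comparability, [X] would bound every aleph_n and hence their supremum [W]. *)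
Lemma card_lt_aleph_omegaP X : card_lt_aleph_omega X ->
  exists n Y, is_aleph n Y /\ type_card_le X Y.
Proof.
move=> [W [[_ W_sup] [_ WX]]]; apply: contrapT => none; apply: WX.
apply: W_sup => n Y Yn; have [//|XY] := type_card_le_total Y X.
by case: none; exists n, Y.
Qed.

(** * Alternating sums over the faces of a sequence *)

(** Deleting the entry of [p] at position k, counted from 0, contributes with sign (-1)^k. *)
Fixpoint altsum (T : Type) (V : zmodType) (G : seq T -> V) (p : seq T) : V :=
  if p is j :: q then G q - altsum (fun r => G (j :: r)) q else 0.

Lemma eq_altsum (T : eqType) (V : zmodType) (G H : seq T -> V) p :
  (forall r, subseq r p -> (size r).+1 = size p -> G r = H r) ->
  altsum G p = altsum H p.
Proof.
elim: p G H => //= j q IH G H eqGH; congr (_ - _).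
  by apply: eqGH => //; apply: subseq_cons.
apply: IH => r rq sz_r; apply: eqGH; last by rewrite /= sz_r.
by rewrite /= eqxx.
Qed.

Lemma altsum_morph (T : Type) (R : pzRingType) (U V : lmodType R)
    (h : {linear U -> V}) (G : seq T -> U) p :
  h (altsum G p) = altsum (fun r => h (G r)) p.
Proof. by elim: p G => [|j q IH] G /=; rewrite ?linear0 // linearB IH. Qed.

Lemma altsumD (T : Type) (V : zmodType) (G H : seq T -> V) p :
  altsum (fun r => G r + H r) p = altsum G p + altsum H p.
Proof.
elim: p G H => [|j q IH] G H /=; first by rewrite addr0.
by rewrite IH opprD addrACA.
Qed.

Lemma altsumZ (T : Type) (R : pzRingType) (V : lmodType R) a
    (G : seq T -> V) p :
  altsum (fun r => a *: G r) p = a *: altsum G p.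
Proof. by elim: p G => [|j q IH] G /=; rewrite ?scaler0 // scalerBr IH. Qed.

Lemma altsumN (T : Type) (V : zmodType) (G : seq T -> V) p :
  altsum (fun r => - G r) p = - altsum G p.
Proof.
by elim: p G => [|j q IH] G /=; rewrite ?oppr0 // opprB IH opprK addrC.
Qed.

Lemma altsumB (T : Type) (V : zmodType) (G H : seq T -> V) p :
  altsum (fun r => G r - H r) p = altsum G p - altsum H p.
Proof.
by rewrite altsumD altsumN.
Qed.

(** The simplicial identity: terms deleting the first entry first and terms deleting it second
    cancel; those keeping it vanish by induction. *)
Lemma altsum_altsum (T : Type) (V : zmodType) (G : seq T -> V) p :
  altsum (altsum G) p = 0.
Proof.
elim: p G => //= j q IH G.
by rewrite altsumB (IH (fun r => G (j :: r))) subr0 subrr.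
Qed.

Definition signed (V : zmodType) n (v : V) := if odd n then - v else v.

Lemma altsum_rcons (T : Type) (V : zmodType) (G : seq T -> V) p t :
  altsum G (rcons p t) =
  altsum (fun r => G (rcons r t)) p + signed (size p) (G p).
Proof.
elim: p G => [|j q IH] G /=; first by rewrite subr0 add0r.
by rewrite IH opprD addrA /signed /=; case: odd; rewrite ?opprK.
Qed.

(** * The bar complex *)

(** Transfinite recursion with a choice at each stage, where the constraint at [a] may refer to the
    values already chosen below [a]. *)
Lemma well_founded_choice (A X : Type) (lt : A -> A -> Prop)
    (P : A -> (A -> X) -> X -> Prop) (x0 : X) :
  well_founded lt ->
  (forall a f g v, (forall b, lt b a -> f b = g b) -> P a f v -> P a g v) ->
  (forall a f, (forall b, lt b a -> P b f (f b)) -> exists v, P a f v) ->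
  exists f, forall a, P a f (f a).
Proof.
move=> lt_wf P_local P_step.
have /choice[next nextP] (af : A * (A -> X)) :
    exists v, (exists w, P af.1 af.2 w) -> P af.1 af.2 v.
  have [[w Pw]|noP] := pselect (exists w, P af.1 af.2 w); first by exists w.
  by exists x0 => /noP.
(* Values are available below [a] only; they are padded with [x0] to a total function, which is
   harmless because [P] is local. *)
pose trunc a (rec : forall b, lt b a -> X) b :=
  if pselect (lt b a) is left ba then rec b ba else x0.
pose f := Fix lt_wf (fun=> X) (fun a rec => next (a, trunc a rec)).
have fE a : f a = next (a, trunc a (fun b _ => f b)).
  rewrite /f Fix_eq // => b g h gh; congr (next (b, _)).
  by apply/funext => c; rewrite /trunc; case: pselect => // cb; rewrite gh.
exists f; elim/(well_founded_ind lt_wf) => a IH.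
have f_trunc b : lt b a -> f b = trunc a (fun b _ => f b) b.
  by rewrite /trunc; case: pselect.
have [v Pv] := P_step a f IH.
have Pnext : P a (trunc a (fun b _ => f b)) (f a).
  by rewrite fE; apply: (nextP (a, _)); exists v; apply: P_local Pv.
by apply: P_local Pnext => b ba; rewrite -f_trunc.
Qed.

(** * Descent of Hom-exactness along a resolution *)

Section HomExactness.

Variables (R : pzRingType) (P : int -> lmodType R).
Variable d : forall n : int, {linear P n -> P (n + 1)}.
Hypothesis P_proj : forall n, projective (P n).
Hypothesis dd0 : forall n x, d (n + 1) (d n x) = 0.

(* Exactness of Hom(P, im beta), expressed through lifts to B along beta. *)
Definition Hom_exact_image (B C : lmodType R) (beta : {linear B -> C}) :=
  forall n (f : {linear P (n + 1) -> B}), (forall y, beta (f (d n y)) = 0) ->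
    exists g : {linear P (n + 1 + 1) -> B},
      forall x, beta (g (d (n + 1) x)) = beta (f x).

(** Dimension shifting: [pi f d] lifts along [alpha], and exactness for [alpha] provides [g] with
    [alpha g d = pi f d]. Then [pi f - alpha g] kills the image of [d] and extends, and [beta] does
    not see the correction. The map [pi] will project [B] onto one degree of the bar complex. *)
Lemma Hom_exact_image_step (A B C : lmodType R) (alpha : {linear A -> B})
    (pi : {linear B -> B}) (beta : {linear B -> C}) :
  Hom_exact d B -> (forall y, beta (pi y) = beta y) ->
  (forall z, beta (alpha z) = 0) ->
  (forall y, beta y = 0 -> exists z, alpha z = pi y) ->
  Hom_exact_image alpha -> Hom_exact_image beta.
Proof.
move=> B_exact beta_pi beta_alpha exact_B alpha_exact n.
(* The lift lives one place to the left of [f], and exactness is applied to it there, so the index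
   must be exhibited as a successor. *)
have [{}n ->] : exists m, n = m + 1 by exists (n - 1); rewrite subrK.
move=> f fd0; have [|f1 f1E] := projective_lift
  (f := pi \o f \o d (n + 1)) (g := alpha) (@P_proj (n + 1)).
  by move=> x; apply: exact_B.
have [|g gE] := alpha_exact n f1.
  by move=> y; rewrite f1E /= dd0 !linear0.
have [|h hE] := (B_exact (n + 1) ((pi \o f) \- (alpha \o g))).1.
  by move=> y /=; rewrite gE f1E /= subrr.
by exists h => x; rewrite hE /= linearB beta_pi beta_alpha subr0.
Qed.

(** Start of the descent: since [r] retracts onto the kernel, [pi f - r pi f] vanishes on the image
    of [d] itself, not only after [beta]. *)
Lemma Hom_exact_image_split (B C : lmodType R) (pi r : {linear B -> B})
    (beta : {linear B -> C}) :
  Hom_exact d B -> (forall y, beta (pi y) = beta y) ->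
  (forall y, beta (r y) = 0) -> (forall y, beta y = 0 -> r (pi y) = pi y) ->
  Hom_exact_image beta.
Proof.
move=> B_exact beta_pi beta_r r_ker n f fd0.
have [|g gE] := (B_exact n ((pi \o f) \- (r \o pi \o f))).1.
  by move=> y /=; rewrite r_ker // subrr.
by exists g => x; rewrite gE /= linearB beta_pi beta_r subr0.
Qed.

End HomExactness.

(** * Chains, boundary and cones *)

Section BarComplex.

Variables (R : pzRingType) (disp : Order.disp_t) (I : preorderType disp).
Variable S : direct_system R I.

(** Zero off the order relation, so that the boundary has one formula on all sequences, chains or
    not. *)
Definition transition i j : {linear S i -> S j} :=
  match @idP (i <= j)%O with
  | ReflectT ij => dsys_map S ij
  | ReflectF _ => GRing.null_fun (S j)
  end.

Lemma transitionE i j (ij : (i <= j)%O) x : transition i j x = dsys_map S ij x.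
Proof.
rewrite /transition; case: {-}_ / idP => // ij'.
by rewrite (bool_irrelevance ij' ij).
Qed.

Lemma transition_comp i j k x : (i <= j)%O -> (j <= k)%O ->
  transition j k (transition i j x) = transition i k x.
Proof.
move=> ij jk; have ik := le_trans ij jk.
by rewrite !transitionE dsys_map_comp.
Qed.

(* B is the direct sum of the S i over all pairs (i, p), i.e. over all nonempty
   sequences i :: p; only those with path <=%O i p belong to the bar complex. *)
Variables (B : lmodType R) (io : forall s : I * seq I, {linear S s.1 -> B}).
Hypothesis B_univ : forall (N : lmodType R) (g : forall s, {linear S s.1 -> N}),
  exists h : {linear B -> N}, forall s x, h (io s x) = g s x.
Hypothesis B_ind : forall E : B -> Prop,
  E 0 -> (forall x y, E x -> E y -> E (x + y)) ->
  (forall s x, E (io s x)) -> forall x, E x.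

Local Notation gen i p := (io (i, p) : S i -> B).

Lemma extend_to_B (N : lmodType R) (g : forall s : I * seq I, S s.1 -> N) :
  (forall s, linear (g s)) ->
  exists h : {linear B -> N}, forall i p x, h (gen i p x) = g (i, p) x.
Proof.
move=> g_lin; have gP s := linear_fun_exists (g_lin s).
have [h hE] := B_univ (fun s => sval (cid (gP s))).
by exists h => i p x; rewrite hE; case: cid.
Qed.

Lemma B_ext (N : lmodType R) (g h : {linear B -> N}) :
  (forall i p x, g (gen i p x) = h (gen i p x)) -> forall y, g y = h y.
Proof.
move=> gh; apply: B_ind => [|x y gx gy|[i p] x]; last exact: gh.
  by rewrite !linear0.
by rewrite !linearD gx gy.
Qed.

Let face0 (s : I * seq I) (x : S s.1) : B :=
  if s.2 is j :: q then gen j q (transition s.1 j x) else 0.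

Let boundary_exists : exists d : {linear B -> B}, forall i p x,
  d (gen i p x) = @face0 (i, p) x - altsum (fun r => gen i r x) p.
Proof.
apply: (@extend_to_B _
  (fun s x => @face0 s x - altsum (fun r => gen s.1 r x) s.2)).
move=> [i p] a /= x y; rewrite scalerBr addrACA -opprD; congr (_ - _).
  by rewrite /face0 /=; case: p => [|j q]; rewrite ?linearP // scaler0 addr0.
rewrite -altsumZ -altsumD; apply: eq_altsum => r _ _; exact: linearP.
Qed.

Definition boundary : {linear B -> B} := sval (cid boundary_exists).

Lemma boundaryE i p x : boundary (gen i p x) =
  (if p is j :: q then gen j q (transition i j x) else 0)
  - altsum (fun r => gen i r x) p.
Proof. by rewrite /boundary; case: cid => d /= ->. Qed.

Lemma boundary_cons i j q x : boundary (gen i (j :: q) x) =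
  gen j q (transition i j x) - altsum (fun r => gen i r x) (j :: q).
Proof. exact: boundaryE. Qed.

Let cone_exists t : exists h : {linear B -> B}, forall i p x,
  h (gen i p x) = gen i (rcons p t) x.
Proof.
apply: (@extend_to_B _ (fun s x => gen s.1 (rcons s.2 t) x)) => s.
exact: linearP.
Qed.

Definition cone t : {linear B -> B} := sval (cid (cone_exists t)).

Lemma coneE t i p x : cone t (gen i p x) = gen i (rcons p t) x.
Proof. by rewrite /cone; case: cid => h /= ->. Qed.

Definition is_chain k (i : I) p := path <=%O i p && (size p == k).

Let chain_proj_exists k : exists h : {linear B -> B}, forall i p x,
  h (gen i p x) = if is_chain k i p then gen i p x else 0.
Proof.
apply: (@extend_to_B _
  (fun s x => if is_chain k s.1 s.2 then gen s.1 s.2 x else 0)).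
move=> s a x y; case: is_chain; first exact: linearP.
by rewrite scaler0 addr0.
Qed.

Definition chain_proj k : {linear B -> B} := sval (cid (chain_proj_exists k)).

Lemma chain_projE k i p x :
  chain_proj k (gen i p x) = if is_chain k i p then gen i p x else 0.
Proof. by rewrite /chain_proj; case: cid => h /= ->. Qed.

(** Appending [t] commutes with every face except the new last one, which returns the generator with
    a sign. For empty [p], deleting [i] would leave an extra face at [t]. *)
Lemma boundary_cone t i p x : p != [::] ->
  boundary (cone t (gen i p x)) =
  cone t (boundary (gen i p x)) - signed (size p) (gen i p x).
Proof.
case: p => // j q _; rewrite coneE rcons_cons !boundary_cons (linearB (cone t)).
rewrite (altsum_morph (cone t)) coneE -rcons_cons altsum_rcons opprD addrA.
congr (_ - _ - _).
by apply: eq_altsum => r _ _; rewrite coneE.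
Qed.

(** Double faces that keep [i] cancel by [altsum_altsum]; those that delete it cancel against the
    boundary of the first face. The chain condition makes the transitions compose. *)
Lemma boundary_boundary k i p x :
  is_chain k i p -> boundary (boundary (gen i p x)) = 0.
Proof.
case: p => [|j p] /andP[chain_ijp _].
  by rewrite boundaryE /= subr0 linear0.
move: chain_ijp => /= /andP[ij chain_jp].
pose y := transition i j x.
pose head r := if r is l :: q then gen l q (transition i l x) else 0.
rewrite [X in boundary X]boundary_cons (linearB boundary).
rewrite (altsum_morph boundary).
have -> : altsum (fun r => boundary (gen i r x)) (j :: p) =
    altsum (fun r => head r - altsum (fun r => gen i r x) r) (j :: p).
  by apply: eq_altsum => r _ _; rewrite boundaryE.
rewrite altsumB altsum_altsum subr0 boundaryE.
suff -> : (if p is l :: q then gen l q (transition j l y) else 0) = head p.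
  exact: subrr.
by case: p chain_jp => //= l q /andP[jl _]; rewrite /y transition_comp.
Qed.

Definition chains_in (J : set I) k i p :=
  [/\ is_chain k i p, J i & forall j, j \in p -> J j].

Lemma chains_in_face (J : set I) k i j q :
  chains_in J k.+1 i (j :: q) ->
  chains_in J k j q /\
  forall r, subseq r (j :: q) -> (size r).+1 = size (j :: q) ->
    chains_in J k i r.
Proof.
move=> [/andP[ijq /eqP[sz_q]] Ji Jjq]; split.
  split=> [||l lq]; last by apply: Jjq; rewrite in_cons lq orbT.
    by have /= /andP[_ jq] := ijq; rewrite /is_chain jq sz_q eqxx.
  by apply: Jjq; rewrite mem_head.
move=> r rjq [sz_r]; split=> // [|l lr]; last exact/Jjq/(mem_subseq rjq).
by rewrite /is_chain -sz_q sz_r eqxx (subseq_path le_trans rjq).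
Qed.

Lemma boundary_agree (J : set I) k (N : lmodType R) (g h : {linear B -> N}) :
  (forall i p x, chains_in J k i p -> g (gen i p x) = h (gen i p x)) ->
  forall i p x, chains_in J k.+1 i p ->
    g (boundary (gen i p x)) = h (boundary (gen i p x)).
Proof.
move=> gh i [|j q] x; first by case=> /andP[].
move=> /chains_in_face[jqJ facesJ].
rewrite boundary_cons (linearB g) (linearB h) gh //.
rewrite (altsum_morph g) (altsum_morph h).
by congr (_ - _); apply: eq_altsum => r rp sz_r; apply/gh/facesJ.
Qed.

(* H^(m+1) of the cochain complex of the system Hom(S_i, N), i in J, vanishes
   for all m >= k and all N. *)
Definition acyclic_above k (J : set I) :=
  forall m, (k <= m)%N -> forall (N : lmodType R) (c : {linear B -> N}),
    (forall i p x, chains_in J m.+2 i p -> c (boundary (gen i p x)) = 0) ->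
    exists b : {linear B -> N}, forall i p x, chains_in J m.+1 i p ->
      b (boundary (gen i p x)) = c (gen i p x).

Lemma acyclic_above_set0 k : acyclic_above k set0.
Proof. by move=> m _ N c _; exists c => i p x []. Qed.

(** The cocycle condition on the chain extended by [t] writes [c], up to the sign (-1)^(m+1), as [c]
    of the cone of the boundary. *)
Lemma acyclic_above_max (J : set I) t :
  J t -> (forall i, J i -> (i <= t)%O) -> acyclic_above 0 J.
Proof.
move=> Jt t_max m _ N c c_cocycle.
have [|b bE] := @linear_fun_exists R B N (fun y => signed m.+1 (c (cone t y))).
  move=> a y z; rewrite !linearP /signed.
  by case: odd; rewrite // opprD scalerN.
exists b => i p x [/andP[chain_ip /eqP sz_p] Ji Jp]; rewrite bE.
have chain_ipt : chains_in J m.+2 i (rcons p t).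
  split=> //; last by move=> j; rewrite mem_rcons in_cons => /predU1P[->|/Jp].
  rewrite /is_chain rcons_path chain_ip size_rcons sz_p eqxx andbT /=.
  apply: t_max; have := mem_last i p; rewrite in_cons => /predU1P[->//|/Jp//].
(* The homotopy formula needs a nonempty [p]: the degree m + 1 is positive. *)
have p_neq0 : p != [::] by case: p sz_p {chain_ip Jp chain_ipt}.
have := c_cocycle _ _ x chain_ipt; rewrite -coneE boundary_cone // linearB sz_p.
move=> /eqP; rewrite subr_eq0 => /eqP ->; rewrite /signed.
by case: odd; rewrite ?linearN ?opprK.
Qed.

Lemma chains_in_sub (J J' : set I) k i p :
  J `<=` J' -> chains_in J k i p -> chains_in J' k i p.
Proof. by move=> JJ' [chain_ip Ji Jp]; split=> [||j /Jp]; by [|apply: JJ']. Qed.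

(** * Goblot's step along a well-ordered chain of subsets *)

Section Chain.

Variables (A : Type) (J : A -> set I).
Hypothesis J_total : forall a b, J a `<=` J b \/ J b `<=` J a.

Lemma chains_in_bigcup (D : set A) k i p :
  chains_in (\bigcup_(a in D) J a) k i p ->
  exists2 a, D a & chains_in (J a) k i p.
Proof.
move=> [chain_ip [a Da Jai] Jp].
suff [b Db [Jbi Jbp]] : exists2 b, D b & J b i /\ forall j, j \in p -> J b j.
  by exists b.
elim: p Jp {chain_ip} => [|j p IH] Jp; first by exists a.
have [|b Db [Jbi Jbp]] := IH.
  by move=> l lp; apply: Jp; rewrite in_cons lp orbT.
have [c Dc Jcj] := Jp j (mem_head _ _).
have [Jbc|Jcb] := J_total b c.
  exists c => //; split=> [|l]; first exact: Jbc.
  by rewrite in_cons => /predU1P[->|/Jbp/Jbc].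
exists b => //; split=> // l.
by rewrite in_cons => /predU1P[->|/Jbp]; first exact: Jcb.
Qed.

Lemma glue_cochains (D : set A) k (N : lmodType R) (g : A -> {linear B -> N}) :
  (forall a b, D a -> D b -> J a `<=` J b ->
    forall i p x, chains_in (J a) k i p -> g b (gen i p x) = g a (gen i p x)) ->
  exists h : {linear B -> N}, forall a, D a ->
    forall i p x, chains_in (J a) k i p -> h (gen i p x) = g a (gen i p x).
Proof.
move=> g_compat.
have /choice[g' g'E] (s : I * seq I) : exists g' : {linear B -> N},
    forall a, D a -> chains_in (J a) k s.1 s.2 ->
    forall x, g' (gen s.1 s.2 x) = g a (gen s.1 s.2 x).
  have [[a [Da sa]]|none] :=
    pselect (exists a, D a /\ chains_in (J a) k s.1 s.2); last first.
    by exists (GRing.null_fun N) => a Da sa; case: none; exists a.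
  exists (g a) => b Db sb x; have [ab|ba] := J_total a b.
    by rewrite (g_compat a b).
  by rewrite (g_compat b a).
have [|h hE] := @extend_to_B N (fun s x => g' s (gen s.1 s.2 x)).
  by move=> [i p] a x y /=; rewrite !linearP.
by exists h => a Da i p x ip; rewrite hE (g'E (i, p) a).
Qed.

Variable lt : A -> A -> Prop.
Hypothesis lt_wf : well_founded lt.
Hypothesis lt_total : forall a b, [\/ lt a b, a = b | lt b a].
Hypothesis J_mono : forall a b, lt a b -> J a `<=` J b.

(** One degree is lost because two primitives differ by a cocycle one degree lower, which must be a
    coboundary on the union of the earlier subsets before a primitive can be corrected to extend the
    earlier ones. *)
Lemma acyclic_above_bigcup k :
  (forall a, acyclic_above k (J a)) ->
  (forall a, acyclic_above k (\bigcup_(b in [set b | lt b a]) J b)) ->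
  acyclic_above k.+1 (\bigcup_a J a).
Proof.
move=> J_acyclic Jlt_acyclic [//|m] km N c c_cocycle.
(* The recursion chooses maps on all of [B], but only their values on chains in [J a] matter, so
   extending earlier choices is required there alone. *)
pose P a (f : A -> {linear B -> N}) (v : {linear B -> N}) :=
  (forall i p x, chains_in (J a) m.+2 i p ->
    v (boundary (gen i p x)) = c (gen i p x)) /\
  (forall b, lt b a -> forall i p x, chains_in (J b) m.+1 i p ->
    v (gen i p x) = f b (gen i p x)).
have compat (D : set A) f : (forall a, D a -> P a f (f a)) ->
    forall a b, D a -> D b -> J a `<=` J b -> forall i p x,
    chains_in (J a) m.+1 i p -> f b (gen i p x) = f a (gen i p x).
  move=> Pf a b Da Db Jab i p x ip; case: (lt_total a b) => [ab|->//|ba].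
    exact: (Pf b Db).2.
  by rewrite ((Pf a Da).2 b) //; apply: chains_in_sub ip.
have primitive (D : set A) f (h : {linear B -> N}) :
    (forall a, D a -> P a f (f a)) ->
    (forall a, D a -> forall i p x, chains_in (J a) m.+1 i p ->
      h (gen i p x) = f a (gen i p x)) ->
    forall i p x, chains_in (\bigcup_(a in D) J a) m.+2 i p ->
      h (boundary (gen i p x)) = c (gen i p x).
  move=> Pf hE i p x /chains_in_bigcup[a Da ip].
  by rewrite (boundary_agree (g := h) (h := f a) (hE a Da) _ ip) (Pf a Da).1.
(* Here [c] is just an inhabitant of the type of maps, the default value of the recursion. *)
have [a f g v fg [vc vf]|a f Pf|b Pb] := well_founded_choice (P := P) c lt_wf.
- by split=> // b ba i p x ip; rewrite -fg //; apply: vf.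
- have [g gE] := glue_cochains (compat [set b | lt b a] f Pf).
  have [b' b'E] : exists b' : {linear B -> N}, forall i p x,
      chains_in (J a) m.+2 i p -> b' (boundary (gen i p x)) = c (gen i p x).
    apply: (J_acyclic a m.+1 (leqW km)) => i p x ip; apply: c_cocycle.
    by apply: chains_in_sub ip; apply: bigcup_sup.
  have UJ : \bigcup_(b in [set b | lt b a]) J b `<=` J a.
    by apply: bigcup_sub => b; apply: J_mono.
  (* On the earlier union the primitive [b'] and the glued [g] differ by a cocycle, hence by [e] of
     the boundary. *)
  have [|e eE] := Jlt_acyclic a m km N (b' \- g).
    move=> i p x ip /=; rewrite (primitive _ _ _ Pf gE) // b'E ?subrr //.
    exact: chains_in_sub ip.
  (* Still a primitive, because the boundary squares to zero, and now equal to [g] on earlier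
     chains. *)
  exists (b' \- (e \o boundary)); split=> [i p x ip|b ba i p x ip] /=.
    case: (ip) => chain_ip _ _.
    by rewrite (boundary_boundary _ chain_ip) linear0 subr0 b'E.
  rewrite eE /=; first by rewrite subKr; apply: gE.
  by apply: chains_in_sub ip; apply: bigcup_sup.
have Pb' a : [set: A] a -> P a b (b a) by [].
have [h hE] := glue_cochains (compat setT b Pb').
by exists h => i p x ip; apply: (primitive setT b h Pb' hE).
Qed.

End Chain.

Lemma chain_proj_idem k y : chain_proj k (chain_proj k y) = chain_proj k y.
Proof.
apply: (B_ext (g := chain_proj k \o chain_proj k)) => i p x /=.
rewrite chain_projE; case: ifP => [ip|_]; last exact: linear0.
by rewrite chain_projE ip.
Qed.

Lemma boundary_boundary_proj k y : boundary (boundary (chain_proj k y)) = 0.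
Proof.
apply: (B_ext (g := boundary \o boundary \o chain_proj k)
              (h := GRing.null_fun B)) => i p x /=.
by rewrite chain_projE; case: ifP => [/boundary_boundary|]; rewrite ?linear0.
Qed.

Lemma boundary_proj k y : chain_proj k (boundary (chain_proj k.+1 y)) =
  boundary (chain_proj k.+1 y).
Proof.
apply: (B_ext (g := chain_proj k \o boundary \o chain_proj k.+1)
              (h := boundary \o chain_proj k.+1)) => i p x /=.
rewrite chain_projE; case: ifP => [ip|_]; last by rewrite !linear0.
have ip_in : chains_in setT k.+1 i p by [].
apply: (boundary_agree (g := chain_proj k) (h := idfun) _ x ip_in).
by move=> j q z [jq _ _] /=; rewrite chain_projE jq.
Qed.

(** * Exactness of the bar complex over a directed set *)

Section Resolution.

Hypothesis I_directed : directed I.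

Lemma directed_seq (p : seq I) : exists t, forall j, j \in p -> (j <= t)%O.
Proof.
have [[i0 _] I_dir] := I_directed.
elim: p => [|j p [t tP]]; first by exists i0.
have [u [ju tu]] := I_dir j t; exists u => l.
by rewrite in_cons => /predU1P[->//|/tP lt]; apply: le_trans tu.
Qed.

(** An element involves finitely many generators, so some [t] lies above all their indices, and
    coning off [t] is a homotopy on that element. *)
Lemma bar_exact k y : boundary (chain_proj k.+1 y) = 0 ->
  exists z, boundary (chain_proj k.+2 z) = chain_proj k.+1 y.
Proof.
have [_ I_dir] := I_directed.
pose homotopy t y :=
  chain_proj k.+2 (cone t (chain_proj k.+1 y)) = cone t (chain_proj k.+1 y) /\
  boundary (cone t (chain_proj k.+1 y)) =
    cone t (boundary (chain_proj k.+1 y)) - signed k.+1 (chain_proj k.+1 y).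
(* Asking for every [u] above [t] makes the property stable under sums. *)
have [t] : exists t, forall u, (t <= u)%O -> homotopy u y.
  have signed0 (V : zmodType) n : signed n (0 : V) = 0.
    by rewrite /signed oppr0 if_same.
  apply: (B_ind (E := fun y => exists t, forall u, (t <= u)%O -> homotopy u y)).
  - have [[t _] _] := I_directed; exists t => u _.
    by rewrite /homotopy !linear0 signed0 subr0.
  - move=> {}y z [t tP] [t' t'P]; have [v [tv t'v]] := I_dir t t'.
    exists v => u vu; have [py hy] := tP u (le_trans tv vu).
    have [pz hz] := t'P u (le_trans t'v vu).
    split; first by rewrite !linearD py pz.
    rewrite !linearD hy hz addrACA; congr (_ + _).
    by rewrite /signed; case: odd; rewrite ?opprD.
  - move=> [i p] x; have [t tP] := directed_seq (i :: p); exists t => u tu.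
    rewrite /homotopy chain_projE; case: ifP => [ip|_]; last first.
      by rewrite !linear0 signed0 subr0.
    have [chain_ip /eqP sz_p] := andP ip; split; last first.
      by rewrite boundary_cone ?sz_p //; case: (p) sz_p.
    rewrite coneE chain_projE /is_chain rcons_path chain_ip size_rcons sz_p eqxx.
    by rewrite (le_trans _ tu) //= tP // mem_last.
move=> /(_ t (lexx t))[proj_cone bd_cone] y0.
exists (- signed k.+1 (cone t (chain_proj k.+1 y))); move: bd_cone.
rewrite y0 linear0 sub0r => bd_cone; rewrite /signed in bd_cone *.
by case: odd bd_cone => bd_cone;
  rewrite ?opprK ?linearN proj_cone bd_cone ?opprK.
Qed.

(** * Acyclicity of subsets closed under chosen upper bounds *)

Section UpperBoundClosure.

Variable ub : I -> I -> I.
Hypothesis ub_geP : forall i j, (i <= ub i j)%O /\ (j <= ub i j)%O.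

Definition ub_closed : set (set I) :=
  [set J | forall i j, J i -> J j -> J (ub i j)].

Local Notation cl := (smallest ub_closed).

Lemma ub_closure_closed X : ub_closed (cl X).
Proof.
move=> i j Xi Xj J JP; apply: JP.1; first exact: (Xi J JP).
exact: (Xj J JP).
Qed.

Lemma ub_closure_mono X Y : X `<=` Y -> cl X `<=` cl Y.
Proof. by apply: sub_smallest2r; apply: ub_closure_closed. Qed.

Lemma ub_closure_setT : cl setT = setT.
Proof. by apply: smallest_id. Qed.

Lemma ub_closure_bigcup (A : Type) (K : A -> set I) (D : set A) :
  (forall a b, K a `<=` K b \/ K b `<=` K a) ->
  cl (\bigcup_(a in D) K a) = \bigcup_(a in D) cl (K a).
Proof.
move=> K_total; apply/seteqP; split; last first.
  by apply: bigcup_sub => a Da; apply: ub_closure_mono; apply: bigcup_sup.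
apply: smallest_sub => [i j [a Da Kai] [b Db Kbj]|i [a Da Kai]]; last first.
  by exists a => //; apply: sub_gen_smallest.
have [ab|ba] := K_total a b.
  by exists b => //; apply: ub_closure_closed => //; apply: ub_closure_mono Kai.
by exists a => //; apply: ub_closure_closed => //; apply: ub_closure_mono Kbj.
Qed.

Lemma ub_closure_countable X : countable X -> countable (cl X).
Proof.
move=> X_countable.
pose F := fix F n := if n is m.+1 then
  [set ub p.1 p.2 | p in F m `*` F m] `|` F m else X.
have F_countable n : countable (F n).
  elim: n => //= n IH.
  suff : countable (\bigcup_(b in [set: bool])
      (if b then [set ub p.1 p.2 | p in F n `*` F n] else F n)).
    apply: sub_countable; apply: subset_card_le => i [Fi|Fi].
      by exists true.
    by exists false.
  apply: bigcup_countable => [//|[] _ //].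
  exact: sub_countable (card_image_le _ _) (countableX IH IH).
have F_mono m n : (m <= n)%N -> F m `<=` F n.
  move=> /subnK <-; elim: (n - m)%N => // l IH; apply: subset_trans IH _.
  by move=> i Fi; right.
apply: (@sub_countable _ _ _ (\bigcup_n F n)); last exact: bigcup_countable.
apply: subset_card_le; apply: smallest_sub => [i j [m _ Fi] [n _ Fj]|i Xi].
  exists (maxn m n).+1 => //; left; exists (i, j) => //; split=> /=.
    exact: F_mono (leq_maxl m n) _ Fi.
  exact: F_mono (leq_maxr m n) _ Fj.
by exists 0%N.
Qed.

(** An increasing cofinal sequence [t n] exhausts [J] by sets [K n] with greatest element [t n]; the
    union of the earlier sets is empty or again some [K n]. *)
Lemma acyclic_above_countable (J : set I) :
  ub_closed J -> countable J -> acyclic_above 1 J.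
Proof.
move=> J_closed /pfcard_geP[->|[e]]; first exact: acyclic_above_set0.
have eJ n : J (e n) by apply: funS.
pose t := fix t n := if n is m.+1 then ub (t m) (e n) else e 0%N.
have tJ n : J (t n) by elim: n => //= n IH; apply: J_closed.
have t_mono m n : (m <= n)%N -> (t m <= t n)%O.
  move=> /subnK <-; elim: (n - m)%N => // l IH; rewrite addSn /=.
  exact: le_trans IH (ub_geP _ _).1.
pose K n := [set i | J i /\ (i <= t n)%O].
have K_mono m n : (m <= n)%N -> K m `<=` K n.
  by move=> mn i [Ji im]; split=> //; apply: le_trans im (t_mono _ _ mn).
have K_acyclic n : acyclic_above 0 (K n).
  by apply: (acyclic_above_max (t := t n)) => [|i []//]; split.
have -> : J = \bigcup_n K n.
  apply/seteqP; split=> [i Ji|i [n _ []]//].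
  have [n _ <-] := @surj _ _ _ _ e i Ji; exists n => //; split; first exact: eJ.
  by case: n => [|n] /=; [apply: lexx | apply: (ub_geP _ _).2].
apply: (@acyclic_above_bigcup nat K _ (fun m n => (m < n)%N) _ _ _ 0%N).
- move=> m n; have [/K_mono|/ltnW/K_mono] := leqP m n; by [left|right].
- by move=> n; elim/ltn_ind: n => n IH; constructor=> m /IH.
- by move=> m n; case: (ltngtP m n) => ?; [apply: Or31|apply: Or33|apply: Or32].
- by move=> m n /ltnW/K_mono.
- exact: K_acyclic.
case=> [|n].
  rewrite (_ : \bigcup_(_ in _) _ = set0); first exact: acyclic_above_set0.
  by apply/seteqP; split=> // i [].
rewrite (_ : \bigcup_(_ in _) _ = K n); first exact: K_acyclic.
by apply/seteqP; split=> [i [m /= mn]|i Ki]; [exact: K_mono | exists n => /=].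
Qed.

(** Above the countable case only [X] is counted, not its closure. Closure commutes with unions of
    chains, so a filtration of [X] gives one of [cl X], and the union of the terms before [a] is the
    closure of a subset of [K a], covered by induction. *)
Lemma acyclic_above_aleph n Y (X : set I) :
  is_aleph n Y -> X #<= [set: Y] -> acyclic_above n.+1 (cl X).
Proof.
elim: n Y X => [|n IH] Y X /=.
  rewrite card_eq_le => /andP[Y_nat _] XY.
  apply: acyclic_above_countable; first exact: ub_closure_closed.
  by apply: ub_closure_countable; apply: card_le_trans Y_nat.
move=> [Y' [Y'n [Y'Y _] Y_succ]] XY.
have [A [lt [K [lt_wf lt_total K_mono -> KY']]]] :=
  card_successor_filtration (is_aleph_infinite Y'n) Y'Y Y_succ XY.
have K_chain a b : K a `<=` K b \/ K b `<=` K a.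
  by have [/K_mono|->|/K_mono] := lt_total a b; [left|left|right].
rewrite ub_closure_bigcup //.
apply: (@acyclic_above_bigcup A (fun a => cl (K a)) _ lt lt_wf lt_total _ n.+1).
- move=> a b; have [ab|ba] := K_chain a b; [left|right];
    exact: ub_closure_mono.
- by move=> a b /K_mono; apply: ub_closure_mono.
- by move=> a; apply: IH Y'n (KY' a).
- move=> a; rewrite -ub_closure_bigcup //; apply: IH Y'n _.
  apply: card_le_trans (KY' a); apply: subset_card_le.
  by apply: bigcup_sub => b; apply: K_mono.
Qed.

End UpperBoundClosure.

Lemma acyclic_above_aleph_omega :
  card_lt_aleph_omega I -> exists k, acyclic_above k [set: I].
Proof.
move=> /card_lt_aleph_omegaP[n [Y [Yn IY]]]; exists n.+1.
have /choice[ub ubP] (ij : I * I) : exists k, (ij.1 <= k)%O /\ (ij.2 <= k)%O.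
  exact: I_directed.2.
rewrite -(ub_closure_setT (fun i j => ub (i, j))).
by apply: acyclic_above_aleph Yn IY => i j; apply: (ubP (i, j)).
Qed.

(** * The augmentation onto the direct limit *)

Variables (M : lmodType R) (f : forall i, {linear S i -> M}).
Hypothesis f_lim : is_direct_limit f.

Let augmentation_exists : exists e : {linear B -> M}, forall i p x,
  e (gen i p x) = if p is [::] then f i x else 0.
Proof.
apply: (@extend_to_B _ (fun s x => if s.2 is [::] then f s.1 x else 0)).
by move=> [i [|j p]] a x y; rewrite ?linearP ?scaler0 ?addr0.
Qed.

Definition augmentation : {linear B -> M} := sval (cid augmentation_exists).

Lemma augmentationE i p x :
  augmentation (gen i p x) = if p is [::] then f i x else 0.
Proof. by rewrite /augmentation; case: cid => e /= ->. Qed.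

Lemma augmentation_proj y : augmentation (chain_proj 0 y) = augmentation y.
Proof.
apply: (B_ext (g := augmentation \o chain_proj 0)) => i p x /=.
rewrite chain_projE; case: p => //= j p.
by rewrite /is_chain andbF linear0 augmentationE.
Qed.

Lemma boundary_edge i j x : (i <= j)%O ->
  boundary (chain_proj 1 (gen i [:: j] x)) =
  gen j [::] (transition i j x) - gen i [::] x.
Proof.
by move=> ij; rewrite chain_projE /is_chain /= ij boundary_cons /= subr0.
Qed.

Lemma augmentation_boundary y : augmentation (boundary (chain_proj 1 y)) = 0.
Proof.
apply: (B_ext (g := augmentation \o boundary \o chain_proj 1)
              (h := GRing.null_fun M)) => i p x.
have [|ip] := boolP (is_chain 1 i p); last first.
  by rewrite /= chain_projE (negbTE ip) !linear0.
case: p => [|j [|l p]] /andP[//] /=; rewrite andbT => ij _.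
rewrite boundary_edge // linearB !augmentationE transitionE.
by rewrite f_lim.1 subrr.
Qed.

(** The projection of [M] modulo the image and the zero map induce the same cocone, so uniqueness in
    the universal property identifies them. *)
Lemma augmentation_surj m : exists y, augmentation y = m.
Proof.
have [||Q [q qP]] :=
  @quotient_exists R M (fun m => exists y, augmentation y = m).
- by exists 0; apply: linear0.
- by move=> a _ _ [y <-] [z <-]; exists (a *: y + z); apply: linearP.
apply/qP; have [|h [_ h_uniq]] := f_lim.2 Q (fun i => q \o f i).
  by move=> i j ij x /=; rewrite f_lim.1.
have qf i x : q (f i x) = 0.
  by apply/qP; exists (gen i [::] x); rewrite augmentationE.
rewrite (h_uniq q) //; symmetry; rewrite -(h_uniq (GRing.null_fun Q)) //.
by move=> i x /=; rewrite qf.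
Qed.

(** In the quotient [Q] of [B] by the elements whose degree 0 part is a boundary, edges identify
    their two ends, so the [S i] form a cocone. The induced map from [M] recovers the class of [y]
    from its augmentation. *)
Lemma augmentation_exact y : augmentation y = 0 ->
  exists z, boundary (chain_proj 1 z) = chain_proj 0 y.
Proof.
have [||Q [q qP]] := @quotient_exists R B
    (fun y => exists z, boundary (chain_proj 1 z) = chain_proj 0 y).
- by exists 0; rewrite !linear0.
- by move=> a u v [z zu] [w wv]; exists (a *: z + w); rewrite !linearP zu wv.
have [|h [hE _]] := f_lim.2 Q (fun i => q \o io (i, [::])).
  move=> i j ij x /=; apply/eqP; rewrite -subr_eq0 -linearB; apply/eqP/qP.
  exists (gen i [:: j] x); rewrite boundary_edge // transitionE linearB.
  by rewrite !chain_projE.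
have hq : h (augmentation y) = q (chain_proj 0 y).
  apply: (B_ext (g := h \o augmentation) (h := q \o chain_proj 0)) => i p x /=.
  rewrite augmentationE chain_projE; case: p => [|j p]; first exact: hE.
  by rewrite /is_chain andbF !linear0.
move=> y0; move: hq; rewrite y0 linear0 => /esym/qP.
by rewrite chain_proj_idem.
Qed.

(** The boundary, as a cochain with values in the kernel [K], is a cocycle. A primitive of it fixes
    boundaries, which by [bar_exact] are all the cycles. *)
Lemma boundary_splits k : acyclic_above k [set: I] ->
  exists r : {linear B -> B},
    (forall y, boundary (chain_proj k.+1 (r y)) = 0) /\
    (forall y, boundary (chain_proj k.+1 y) = 0 ->
      r (chain_proj k.+1 y) = chain_proj k.+1 y).
Proof.
move=> acyc.
have [||K [inc [inc_inj incP]]] := @submodule_exists R B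
    (fun y => boundary (chain_proj k.+1 y) = 0).
- by rewrite !linear0.
- by move=> a y z y0 z0; rewrite !linearP y0 z0 scaler0 addr0.
have /choice[c0 c0E] y : exists z, inc z = boundary (chain_proj k.+2 y).
  by apply/incP; rewrite boundary_proj boundary_boundary_proj.
have [|c cE] := @linear_fun_exists R B K c0.
  by move=> a y z; apply: inc_inj; rewrite linearP !c0E !linearP.
(* Taken at [k.+1], since cycles are known to be boundaries in positive degree only. *)
have [|b bE] := acyc k.+1 (leqnSn k) K c.
  move=> i p x ip; apply: inc_inj; rewrite cE c0E linear0.
  rewrite -[RHS](boundary_boundary_proj k.+3 (gen i p x)) chain_projE.
  have [ip_chain _ _] := ip; rewrite ip_chain.
  apply: (boundary_agree (g := boundary \o chain_proj k.+2)
                         (h := boundary) _ x ip).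
  by move=> j q y [jq _ _] /=; rewrite chain_projE jq.
exists (inc \o b); split=> [y|y /bar_exact[z <-]].
  by apply/incP; exists (b y).
apply: (B_ext (g := inc \o b \o boundary \o chain_proj k.+2)
              (h := boundary \o chain_proj k.+2)) => i p x /=.
rewrite chain_projE; case: ifP => ip; last by rewrite !linear0.
by rewrite bE // cE c0E chain_projE ip.
Qed.

Section Gorenstein.

Variable P : int -> lmodType R.
Variable d : forall n : int, {linear P n -> P (n + 1)}.
Hypothesis P_proj : forall n, projective (P n).
Hypothesis dd0 : forall n x, d (n + 1) (d n x) = 0.
Hypothesis B_exact : Hom_exact d B.

(** The splitting starts the descent, each dimension shift lowers the degree by one, and the
    augmentation takes the place of a boundary at the end. *)
Lemma augmentation_Hom_exact k :
  acyclic_above k [set: I] -> Hom_exact_image d augmentation.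
Proof.
move=> acyc; have [r [bd_r r_ker]] := boundary_splits acyc.
have : Hom_exact_image d (boundary \o chain_proj k.+1).
  apply: (Hom_exact_image_split (pi := chain_proj k.+1) (r := r)) => //= y.
  by rewrite chain_proj_idem.
elim: k {acyc r bd_r r_ker} => [|k IH] bd_exact.
  apply: (Hom_exact_image_step (pi := chain_proj 0) _ _ _ _ _ _ bd_exact)
    => //=.
  - exact: augmentation_proj.
  - exact: augmentation_boundary.
  - exact: augmentation_exact.
apply: IH.
apply: (Hom_exact_image_step (pi := chain_proj k.+1) _ _ _ _ _ _ bd_exact)
  => //= y.
- by rewrite chain_proj_idem.
- by rewrite boundary_proj boundary_boundary_proj.
- exact: bar_exact.
Qed.

End Gorenstein.

End Resolution.

End BarComplex.

(** * From Hom-exactness to projectivity *)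

Lemma projective_syzygy (R : pzRingType) (M : lmodType R)
    (P : int -> lmodType R) (d : forall n : int, {linear P n -> P (n + 1)})
    (z : int) (u : {linear M -> P z}) :
  (forall n, projective (P n)) -> exact_sequence d ->
  injective u -> (forall x, d z x = 0 <-> exists m, u m = x) ->
  (forall n (f : {linear P (n + 1) -> M}), (forall y, f (d n y) = 0) ->
    exists g : {linear P (n + 1 + 1) -> M}, forall x, g (d (n + 1) x) = f x) ->
  projective M.
Proof.
move=> P_proj d_exact; move: u.
(* The position [z] is a variable so that it can be replaced by [n + 1 + 1] inside the types. *)
have [n ->] : exists n : int, z = n + 1 + 1.
  by exists (z - 1 - 1); rewrite !subrK.
move=> u u_inj uP M_exact.
have [|f fE] := projective_lift (f := d (n + 1)) (g := u) (P_proj (n + 1)).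
  by move=> x; apply/uP/d_exact; exists x.
have [|g gE] := M_exact n f.
  move=> y; apply: u_inj; rewrite fE linear0.
  by apply/d_exact; exists y.
apply: (projective_retract (u := u) (v := g) (P_proj _)) => m.
have /d_exact[y yE] : d (n + 1 + 1) (u m) = 0 by apply/uP; exists m.
by rewrite -yE gE; apply: u_inj; rewrite fE.
Qed.

Theorem proposition2p5 (R : pzRingType) (disp : Order.disp_t)
    (I : preorderType disp) (S : direct_system R I) (M : lmodType R)
    (f : forall i : I, {linear S i -> M}) :
  directed I ->
  card_lt_aleph_omega I ->
  (forall i : I, projective (S i)) ->
  is_direct_limit f ->
  Gorenstein_projective M ->
  projective M.
Proof.
move=> I_dir I_card S_proj f_lim [P [d [[P_proj d_exact d_Hom] [u [u_inj uP]]]]].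
apply: (projective_syzygy P_proj d_exact u_inj uP) => n g gd0.
have [B [io [B_univ B_ind]]] :=
  direct_sum_exists (fun s : I * seq I => S s.1).
have B_proj : projective B by apply: direct_sum_projective B_univ B_ind _.
have dd0 k x : d (k + 1) (d k x) = 0 by apply/d_exact; exists x.
have [k k_acyc] := acyclic_above_aleph_omega B_univ I_dir I_card.
have aug_exact := augmentation_Hom_exact B_ind I_dir f_lim P_proj dd0
  (d_Hom B B_proj) k_acyc.
(* Exactness for the augmentation concerns maps into [B], so [g] is first lifted to [B] by
   projectivity of [P (n + 1)]. *)
have [|h hE] := projective_lift
  (f := g) (g := augmentation B_univ f) (P_proj (n + 1)).
  by move=> x; apply: (augmentation_surj B_univ f_lim).
have [|h' h'E] := aug_exact n h; first by move=> y; rewrite hE gd0.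
by exists (augmentation B_univ f \o h') => x /=; rewrite h'E hE.
Qed.
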